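(* Let $x_0$ be an isolated point of $\mathrm{supp}(d\mu)$. Then there exists $d_0>0$ such that, if $\delta_n=\dfrac{d_0^2}{d_0+\sqrt{2}\,a_{n+1}}$, then for every $n$ at least one of $p_n$ and $p_{n+1}$ has no zeros or one zero in $(x_0-\delta_n,x_0+\delta_n)$. In particular, if $a_\infty=\sup_n a_n<\infty$ and $\delta_\infty=\dfrac{d_0^2}{d_0+\sqrt{2}\,a_\infty}$, then for all large $n$, either $N_n(x_0,\delta_\infty)=1$ or $N_{n+1}(x_0,\delta_\infty)=1$.
   Context: $d\mu$ is a (positive) measure on $\mathbb{R}$ whose support is not a finite number of points and with $\int |x|^n\,d\mu(x)<\infty$ for all $n=0,1,2,\dots$. The orthonormal polynomials $p_n(x)=p_n(x;d\mu)$, $n=0,1,2,\dots$, are uniquely determined by $p_n(x)=\gamma_n x^n+\text{lower order}$ with $\gamma_n>0$, and $\int p_n(x)p_m(x)\,d\mu(x)=\delta_{nm}$. There are recursion coefficients $a_n>0$, $b_n\in\mathbb{R}$ for $n\ge 1$ such that $x p_n(x)=a_{n+1}p_{n+1}(x)+b_{n+1}p_n(x)+a_n p_{n-1}(x)$ for $n\ge 0$ (with the last term absent when $n=0$). For $\delta>0$, $N_n(x_0,\delta)$ denotes the number of zeros of $p_n(x)$ in $(x_0-\delta,x_0+\delta)$. *)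

(* Defs.v *)
From HB Require Import structures.
From mathcomp Require Import all_boot all_order all_algebra finmap.
From mathcomp Require Import all_classical all_reals all_analysis.

Set Implicit Arguments.
Unset Strict Implicit.
Unset Printing Implicit Defensive.

Import Order.TTheory GRing.Theory Num.Theory.
Import numFieldNormedType.Exports.

Local Open Scope classical_set_scope.
Local Open Scope ring_scope.

Definition msupp (R : realType)
    (mu : {measure set (measurableTypeR R) -> \bar R}) : set R :=
  [set x : R | forall U : set R, open U -> U x -> (0 < mu U)%E].

Definition finite_moments (R : realType)
    (mu : {measure set (measurableTypeR R) -> \bar R}) : Prop :=
  forall n : nat, (\int[mu]_(x in [set: R]) (`|x| ^+ n)%:E < +oo)%E.

(* The products p_n p_m are mu-integrable as soon as all moments are finite,
   so the extended-real integrals below are genuine ones. *)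
Definition orthonormal_polys (R : realType)
    (mu : {measure set (measurableTypeR R) -> \bar R})
    (p : nat -> {poly R}) : Prop :=
  [/\ forall n : nat, size (p n) = n.+1,
      forall n : nat, 0 < lead_coef (p n) &
      forall n m : nat,
        (\int[mu]_(x in [set: R]) ((p n).[x] * (p m).[x])%:E
         = ((n == m)%:R)%:E)%E].

(* Only the values a_n, b_n with n >= 1 are constrained; a 0 and b 0 are
   junk. *)
Definition recursion_coefs (R : realType) (p : nat -> {poly R})
    (a b : nat -> R) : Prop :=
  [/\ forall n : nat, 0 < a n.+1,
      'X * p 0%N = a 1%N *: p 1%N + b 1%N *: p 0%N &
      forall n : nat,
        'X * p n.+1 = a n.+2 *: p n.+2 + b n.+2 *: p n.+1 + a n.+1 *: p n].

(* The cardinal is meaningful because the set is finite when p != 0 (fset_set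
   of an infinite set is empty). *)
Definition nzeros (R : realType) (p : {poly R}) (x0 delta : R) : nat :=
  #|` fset_set [set x : R | root p x /\ (x0 - delta < x < x0 + delta)%R] |%N.

Definition delta_of (R : realType) (d a : R) : R :=
  d ^+ 2 / (d + Num.sqrt 2 * a).

(* Main.v *)
Require Import Defs.
From HB Require Import structures.
From mathcomp Require Import all_boot all_order all_algebra finmap.
From mathcomp Require Import all_classical all_reals all_analysis.
From mathcomp Require Import measurable_realfun ring lra polyrcf.

Set Implicit Arguments.
Unset Strict Implicit.
Unset Printing Implicit Defensive.

Import Order.TTheory GRing.Theory Num.Theory.
Import numFieldNormedType.Exports.

Local Open Scope classical_set_scope.
Local Open Scope ring_scope.

(** Let [k n] be the Christoffel-Darboux kernel [sum_(j < n) p_j(x0) p_j], and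
    replace [p n] by its part [s n] orthogonal to [k n], which vanishes at
    [x0]; write [s n = (X - x0) q n].  The [q n] are orthogonal for
    [(x - x0)^2 dmu], whose support stays at distance [d] from [x0], and
    [|s n|^2 = k_(n+1)(x0) / k_n(x0)] lies between two positive constants
    because [mu {x0} > 0].  The Wronskian-like polynomial
    [W = q_n(x0) q_(n+1) - q_(n+1)(x0) q_n] represents, up to a factor of at
    least [1 / a_(n+1)], the functional [(X - x0) f |-> f(x0)], and
    [d |W| <= |(X - x0) W|] bounds [W] by the values of [q_n] and [q_(n+1)] at
    [x0], while Cauchy-Schwarz makes these values small if both polynomials have
    a root near [x0].  Finally, two roots [y1 < y2] of [p n] near [x0]
    must surround [x0], and [k n] is positive at both, so [s n] has the same
    sign at [y1] and [y2] and [q n] has a root between them.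

    If [p n] has no root in [(x0 - r, x0 + r)], Gauss quadrature at the roots of
    [p n] applied to [((X - x0) k n)^2] gives
    [r^2 p_0(x0)^2 <= a_n^2 p_n(x0)^2], and the right-hand side tends to [0] when
    [a] is bounded, since [mu {x0} > 0] makes [sum_j p_j(x0)^2] converge. *)

(** * Polynomial sizes, roots and sign changes *)

Lemma size_XsubC_mul (R : idomainType) (c : R) (f : {poly R}) (n : nat) :
  (size (('X - c%:P) * f)%R <= n.+1)%N = (size f <= n)%N.
Proof.
have [->|f0] := eqVneq f 0; first by rewrite mulr0 size_poly0.
by rewrite size_mul ?polyXsubC_eq0 // size_XsubC.
Qed.

Lemma root_factor (R : idomainType) (f : {poly R}) (y : R) :
  root f y -> exists g, f = ('X - y%:P) * g.
Proof. by move/factor_theorem => [g ->]; exists g; rewrite mulrC. Qed.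

Section SizeBound.
Variables (R : nzRingType) (n : nat).
Implicit Types f g : {poly R}.

Lemma size_polyD_le f g :
  (size f <= n)%N -> (size g <= n)%N -> (size (f + g)%R <= n)%N.
Proof. by move=> fn gn; rewrite (leq_trans (size_polyD _ _)) // geq_max fn. Qed.

Lemma size_polyB_le f g :
  (size f <= n)%N -> (size g <= n)%N -> (size (f - g)%R <= n)%N.
Proof. by move=> fn gn; rewrite size_polyD_le ?size_polyN. Qed.

Lemma size_polyZ_le c f : (size f <= n)%N -> (size (c *: f)%R <= n)%N.
Proof. exact/leq_trans/size_scale_leq. Qed.

End SizeBound.

Lemma constant_sign (R : rcfType) (f : {poly R}) (x y : R) :
  (forall t, ~~ root f t) -> 0 <= f.[x] * f.[y].
Proof.
move=> nr; rewrite leNgt; apply/negP => fxy.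
have [xy|yx] := leP x y.
  by have [t _ rt] := polyrcf.poly_ivt xy (ltW fxy); move: (nr t); rewrite rt.
move: fxy; rewrite mulrC => fyx.
by have [t _ rt] := polyrcf.poly_ivt (ltW yx) (ltW fyx); move: (nr t); rewrite rt.
Qed.

(** [s] collects the roots of odd multiplicity. Splitting off a root toggles its membership in [s],
    which leaves the product with the remaining factor unchanged or multiplies it by a square. *)
Lemma sign_changes (R : rcfType) (f : {poly R}) : f != 0 ->
  exists2 s : seq R, uniq s && all (root f) s &
    exists2 c : R, c != 0 &
      forall x, 0 <= c * (f * \prod_(y <- s) ('X - y%:P)).[x].
Proof.
have [n] := ubnP (size f); elim: n f => // n IH f sf f0.
have [[y fy]|nroot] := pselect (exists y, root f y); last first.
  have nr t : ~~ root f t by apply/negP => ft; apply: nroot; exists t.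
  exists [::] => //; exists f.[0]; first exact: (nr 0).
  by move=> x; rewrite big_nil mulr1 constant_sign.
have [g fE] := root_factor fy.
have g0 : g != 0 by apply: contraNneq f0 => g0; rewrite fE g0 mulr0.
have sg : (size g < n)%N.
  by move: sf; rewrite ltnS fE size_mul ?polyXsubC_eq0 // size_XsubC.
have [s /andP[us rs] [c c0 cs]] := IH g sg g0.
have rfs z : z \in s -> root f z.
  by move=> zs; rewrite fE rootM (allP rs) ?orbT.
have [ys|ys] := boolP (y \in s).
  exists (rem y s); first by rewrite rem_uniq //=; apply/allP => z /mem_rem/rfs.
  exists c => // x; have := cs x.
  by rewrite (perm_big _ (perm_to_rem ys)) big_cons /= fE [_ * g]mulrC mulrA.
exists (y :: s); first by rewrite /= ys us fy; apply/allP.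
exists c => // x; have := cs x.
set P := \prod_(_ <- s) _; rewrite big_cons -/P fE => cgP.
rewrite (_ : _ * _ * _ = ('X - y%:P) ^+ 2 * (g * P)); last by ring.
by rewrite hornerM mulrCA mulr_ge0 // horner_exp sqr_ge0.
Qed.

(** * Cauchy-Schwarz for a weighted semidefinite form *)

Section CauchySchwarz.
Variables (R : rcfType) (L : {scalar {poly R}}) (w : {poly R}).
Hypothesis Lw_ge0 : forall f, 0 <= L (w * (f * f)).

Lemma scalar_CauchySchwarz (f g : {poly R}) :
  L (w * (f * g)) ^+ 2 <= L (w * (f * f)) * L (w * (g * g)).
Proof.
set A := L (w * (f * f)); set B := L (w * (f * g)); set C := L (w * (g * g)).
have quad t : 0 <= A * t ^+ 2 + 2 * B * t + C.
  have := Lw_ge0 (t *: f + g).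
  have -> : w * ((t *: f + g) * (t *: f + g)) =
      t ^+ 2 *: (w * (f * f)) + (2 * t) *: (w * (f * g)) + w * (g * g).
    by rewrite -!mul_polyC; ring.
  by rewrite !linearD !linearZ /= -/A -/B -/C; lra.
have A0 : 0 <= A by exact: Lw_ge0.
have [A_eq0|A_neq0] := eqVneq A 0.
  have [->|B0] := eqVneq B 0; first by rewrite A_eq0 mul0r expr0n.
  (* When [A = 0] the quadratic is affine in [t], and this choice of [t] gives it the value [-1]. *)
  have := quad (- (C + 1) / (2 * B)).
  rewrite A_eq0 mul0r add0r (_ : 2 * B * _ = - (C + 1)); first by lra.
  by field; rewrite B0.
have Agt0 : 0 < A by rewrite lt0r A_neq0.
have := quad (- B / A).
rewrite (_ : _ + _ = (A * C - B ^+ 2) / A); last by field.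
by rewrite pmulr_lge0 ?invr_gt0// subr_ge0.
Qed.

End CauchySchwarz.

(** * Orthonormal polynomials of a linear functional *)

Section Orthonormal.
Variables (R : rcfType) (L : {scalar {poly R}}) (p : nat -> {poly R}).
Hypothesis size_p : forall n, size (p n) = n.+1.
Hypothesis L_p : forall n m, L (p n * p m) = (n == m)%:R.

(** Since [p n] has degree exactly [n], subtracting a multiple of it removes the top coefficient.
    This induction replaces explicit expansions in the basis [p j]. *)
Lemma orthonormal_ind (P : {poly R} -> Prop) (n : nat) :
  P 0 ->
  (forall (c : R) (j : nat) (f : {poly R}),
    (j < n)%N -> (size f <= j)%N -> P f -> P (c *: p j + f)) ->
  forall f : {poly R}, (size f <= n)%N -> P f.
Proof.
move=> P0; elim: n => [|n IHn] PS f sf.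
  by move: sf; rewrite leqn0 size_poly_eq0 => /eqP ->.
have ln0 : (p n)`_n != 0.
  by have := lead_coef_eq0 (p n); rewrite /lead_coef size_p /= -size_poly_eq0
    size_p => ->.
pose g := f - (f`_n / (p n)`_n) *: p n.
have sg : (size g <= n)%N.
  apply/leq_sizeP => j; rewrite leq_eqVlt => /orP[/eqP <-|nj].
    by rewrite coefB coefZ divfK // subrr.
  rewrite coefB coefZ (nth_default 0 (leq_trans sf nj)).
  rewrite (nth_default 0 (_ : size (p n) <= j)%N).
    by rewrite mulr0 subrr.
  by rewrite size_p.
have -> : f = (f`_n / (p n)`_n) *: p n + g by rewrite addrC subrK.
apply: (PS _ _ _ (ltnSn n) sg).
by apply: IHn => // c j h jn; apply: PS; rewrite ltnS ltnW.
Qed.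

Lemma ortho_lt (n : nat) (f : {poly R}) : (size f <= n)%N -> L (p n * f) = 0.
Proof.
move: f; apply: orthonormal_ind => [|c j f jn _ IH]; first by rewrite mulr0
  linear0.
by rewrite mulrDr linearD IH -scalerAr linearZ /= L_p gtn_eqF // mulr0 addr0.
Qed.

Lemma L_sqr_gt0 (f : {poly R}) : f != 0 -> 0 < L (f * f).
Proof.
(* The non-strict bound is carried along because the lower-degree remainder in the induction may be
   zero. *)
suff : (f != 0 -> 0 < L (f * f)) /\ 0 <= L (f * f) by case.
have [n sf] : exists n, (size f <= n)%N by exists (size f).
move: f sf; apply: orthonormal_ind => [|c j g _ sg [gpos gge]].
  by rewrite eqxx mulr0 linear0.
have -> : (c *: p j + g) * (c *: p j + g)
   = c ^+ 2 *: (p j * p j) + (2 * c) *: (p j * g) + g * g.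
  by rewrite -!mul_polyC; ring.
rewrite !linearD !linearZ /= L_p eqxx ortho_lt // mulr1 mulr0 addr0.
split; last by rewrite addr_ge0 // sqr_ge0.
have [->|c0 _] := eqVneq c 0; first by rewrite scale0r add0r expr0n add0r.
by rewrite ltr_pwDl // exprn_even_gt0.
Qed.

(** * The Christoffel-Darboux kernel at [x0] *)

Variable x0 : R.

Definition cd_kernel (n : nat) : {poly R} := \sum_(j < n) (p j).[x0] *: p j.
Local Notation k := cd_kernel.
Local Notation K n := (cd_kernel n).[x0].

Lemma cd_kernelS (n : nat) : k n.+1 = k n + (p n).[x0] *: p n.
Proof. by rewrite /k big_ord_recr. Qed.

Lemma size_cd_kernel (n : nat) : (size (k n) <= n)%N.
Proof.
apply: (leq_trans (size_sum _ _ _)); apply/bigmax_leqP => i _.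
by rewrite (leq_trans (size_scale_leq _ _)) // size_p.
Qed.

Lemma cd_kernel_repr (n : nat) (f : {poly R}) :
  (size f <= n)%N -> L (k n * f) = f.[x0].
Proof.
move: f; apply: orthonormal_ind => [|c j f jn _ IH].
  by rewrite mulr0 linear0 horner0.
rewrite mulrDr linearD IH -scalerAr linearZ /= hornerD hornerZ; congr (_ * _ + _).
rewrite /k mulr_suml linear_sum /= (bigD1 (Ordinal jn)) //= big1 => [|i].
  by rewrite -scalerAl linearZ /= L_p eqxx mulr1 addr0.
by rewrite -val_eqE /= -scalerAl linearZ /= L_p => /negbTE ->; rewrite mulr0.
Qed.

Lemma L_cd_kernel_sqr (n : nat) : L (k n * k n) = K n.
Proof. by rewrite cd_kernel_repr // size_cd_kernel. Qed.

Lemma cd_kernel_diagS (n : nat) : K n.+1 = K n + (p n).[x0] ^+ 2.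
Proof. by rewrite cd_kernelS hornerD hornerZ expr2. Qed.

Lemma cd_kernel_diag_ge (n : nat) : (p 0).[x0] ^+ 2 <= K n.+1.
Proof.
elim: n => [|n IH]; rewrite cd_kernel_diagS; last first.
  by rewrite (le_trans IH) // lerDl sqr_ge0.
by rewrite /k big_ord0 horner0 add0r.
Qed.

Lemma p0_sqr_gt0 : 0 < (p 0).[x0] ^+ 2.
Proof.
have /size_poly1P[c c0 ->] : size (p 0) == 1 by rewrite size_p.
by rewrite hornerC exprn_even_gt0.
Qed.

Lemma cd_kernel_diag_gt0 (n : nat) : 0 < K n.+1.
Proof. exact: lt_le_trans p0_sqr_gt0 (cd_kernel_diag_ge n). Qed.

(* [L] is integration against [mu]; [x0] is an atom of mass [m0] and the rest of
   the support is at distance at least [d] from [x0]. *)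
Variables (d m0 : R).
Hypothesis d_gt0 : 0 < d.
Hypothesis m0_gt0 : 0 < m0.
Hypothesis L_ge0 : forall f : {poly R},
  (forall x, x = x0 \/ d <= `|x - x0| -> 0 <= f.[x]) -> 0 <= L f.
Hypothesis L_mass : forall f : {poly R}, m0 * f.[x0] ^+ 2 <= L (f * f).

(** * Positivity, the atom, and roots close to [x0] *)

Lemma L_sqr_ge0 (f : {poly R}) : 0 <= L (f * f).
Proof. by apply: L_ge0 => x _; rewrite hornerM -expr2 sqr_ge0. Qed.

(** Testing [L_mass] on [k n], whose square has integral [K n], gives [m0 * K n ^ 2 <= K n]. *)
Lemma cd_kernel_diag_le (n : nat) : K n <= m0^-1.
Proof.
have := L_mass (k n); rewrite L_cd_kernel_sqr.
case: n => [_|n]; first by rewrite /k big_ord0 horner0 invr_ge0 ltW.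
rewrite expr2 mulrA ger_pMl ?cd_kernel_diag_gt0 // => mK.
by rewrite -(ler_pM2l m0_gt0) mulfV ?gt_eqF.
Qed.

(** Cauchy-Schwarz with weight [w], applied to [1] and [w], bounds [L (w * w) ^ 2] by a multiple of
    [L w]. *)
Lemma L_ge0_eq0 (w : {poly R}) :
  (forall x, x = x0 \/ d <= `|x - x0| -> 0 <= w.[x]) -> L w = 0 -> w = 0.
Proof.
move=> w_ge0 Lw0; apply/eqP/negPn/negP => /L_sqr_gt0.
have Lw_ge0 (f : {poly R}) : 0 <= L (w * (f * f)).
  by apply: L_ge0 => x xS; rewrite hornerM mulr_ge0 ?w_ge0 // hornerM -expr2
    sqr_ge0.
have := scalar_CauchySchwarz Lw_ge0 1 w; rewrite mul1r !mulr1 Lw0 mul0r => ww.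
by have /eqP -> : L (w * w) == 0; [rewrite -sqrf_eq0 eq_le ww sqr_ge0|rewrite
  ltxx].
Qed.

(** Otherwise [('X - y%:P) * ('X - t%:P)] is nonnegative at [x0] and at distance at least [d] from
    it, while its product with [w * w] equals [p m * w], on which [L] vanishes. The case [y = t]
    rules out a double root near [x0]. *)
Lemma roots_surround (m : nat) (y t : R) (w : {poly R}) :
  p m = ('X - y%:P) * ('X - t%:P) * w -> y <= t ->
  `|y - x0| < d -> `|t - x0| < d -> y < x0 < t.
Proof.
move=> pE yt yd td; apply/negPn/negP => Nyt.
set q := ('X - y%:P) * ('X - t%:P).
have q_ge0 x : x = x0 \/ d <= `|x - x0| -> 0 <= q.[x].
  move=> xS; rewrite /q hornerM !hornerXsubC.
  move: yd td Nyt; rewrite !ltr_norml negb_and -!leNgt => /andP[? ?] /andP[? ?].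
  case: xS => [->|]; first by case/orP => ?; nra.
  by rewrite ler_normr => /orP[?|?] _; nra.
have sw : (size w <= m)%N.
  have := size_p m; rewrite pE -mulrA => sz.
  by rewrite -(size_XsubC_mul t) -(size_XsubC_mul y) sz.
have qww0 : q * (w * w) = 0.
  apply: L_ge0_eq0 => [x xS|]; last by rewrite mulrA -pE ortho_lt.
  by rewrite hornerM mulr_ge0 ?q_ge0 // hornerM -expr2 sqr_ge0.
have /eqP : p m * p m = 0 by rewrite pE -/q mulrACA -mulrA qww0 mulr0.
by rewrite mulf_eq0 orbb -size_poly_eq0 size_p.
Qed.

(** [f - f.[y]%:P] is divisible by ['X - y%:P], so its product with [v] is [p m] times a polynomial
    of lower degree. *)
Lemma L_cofactor_root (m : nat) (y : R) (v f : {poly R}) :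
  p m = ('X - y%:P) * v -> (size f <= m)%N -> L (v * f) = f.[y] * L v.
Proof.
move=> pE sf.
have [h fE] : exists h, f - f.[y]%:P = ('X - y%:P) * h.
  by apply: root_factor; rewrite rootE hornerD hornerN hornerC subrr.
case: m => [|m] in pE sf *.
  by move: sf; rewrite leqn0 size_poly_eq0 => /eqP ->; rewrite mulr0 linear0
    horner0 mul0r.
have sh : (size h <= m)%N.
  rewrite -(size_XsubC_mul y) -fE size_polyB_le //.
  exact: leq_trans (size_polyC_leq1 _) _.
have -> : v * f = f.[y] *: v + p m.+1 * h.
  by rewrite -[in LHS](subrK f.[y]%:P f) fE pE -mul_polyC; ring.
by rewrite linearD linearZ /= ortho_lt ?addr0 // leqW.
Qed.

(** Write [p m = ('X - y%:P) * v]. Applying [L_cofactor_root] to [v] and to [k m] yields [(k m).[y]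
    * L (v * v) = v.[x0] * v.[y]]. The right side is positive, since a root of [v] between [y] and
    [x0] would contradict [roots_surround]. *)
Lemma cd_kernel_root_gt0 (m : nat) (y : R) :
  root (p m) y -> `|y - x0| < d -> 0 < (k m).[y].
Proof.
move=> /root_factor[v pE] yd.
have sv : (size v <= m)%N by rewrite -(size_XsubC_mul y) -pE size_p.
have v0 : v != 0.
  by apply/eqP => v0; move: (size_p m); rewrite pE v0 mulr0 size_poly0.
have Lvv := L_cofactor_root pE sv.
have := L_cofactor_root pE (size_cd_kernel m).
rewrite mulrC cd_kernel_repr // => vx0.
have vv : 0 < v.[x0] * v.[y].
  rewrite ltNge; apply/negP => vv; have [yx0|x0y] := leP y x0.
    move: vv; rewrite mulrC => /(polyrcf.poly_ivt yx0)[t].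
    rewrite in_itv /= => /andP[yt tx0] /root_factor[w vE].
    have td : `|t - x0| < d.
      by move: yd; rewrite !ltr_norml => /andP[? ?]; apply/andP; split; lra.
    move: pE; rewrite vE mulrA => /roots_surround/(_ yt yd td)/andP[_].
    by rewrite ltNge tx0.
  move: vv => /(polyrcf.poly_ivt (ltW x0y))[t].
  rewrite in_itv /= => /andP[x0t ty] /root_factor[w vE].
  have td : `|t - x0| < d.
    by move: yd; rewrite !ltr_norml => /andP[? ?]; apply/andP; split; lra.
  have /roots_surround/(_ ty td yd)/andP[] : p m = ('X - t%:P) * ('X - y%:P) * w.
    by rewrite pE vE; ring.
  by rewrite ltNge x0t.
rewrite -(pmulr_lgt0 _ (L_sqr_gt0 v0)) Lvv.
by rewrite (_ : _ * _ = v.[x0] * v.[y]) // vx0; ring.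
Qed.

(** * Deflation: removing the kernel component and dividing by [X - x0] *)

Definition deflated (n : nat) : {poly R} := p n - ((p n).[x0] / K n) *: k n.
Local Notation s := deflated.

Definition deflated_quo (n : nat) : {poly R} := s n %/ ('X - x0%:P).
Local Notation q := deflated_quo.

(** The index starts at 1 because [k 0] is zero, so that [s 0] is the nonzero constant [p 0]. *)
Lemma deflated_x0 (n : nat) : (s n.+1).[x0] = 0.
Proof.
rewrite /s hornerD hornerN hornerZ divfK ?subrr //.
by rewrite gt_eqF // cd_kernel_diag_gt0.
Qed.

Lemma deflatedE (n : nat) : s n.+1 = ('X - x0%:P) * q n.+1.
Proof. by rewrite mulrC divpK // dvdp_XsubCl; apply/eqP/deflated_x0. Qed.

Lemma size_deflated (n : nat) : (size (s n) <= n.+1)%N.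
Proof.
by rewrite size_polyB_le ?size_polyZ_le ?size_p // leqW // size_cd_kernel.
Qed.

Lemma size_deflated_quo (n : nat) : (size (q n.+1) <= n.+1)%N.
Proof. by rewrite -(size_XsubC_mul x0) -deflatedE size_deflated. Qed.

(** At a root [y] of [p n.+1], the value [(y - x0) * (q n.+1).[y]] is a fixed nonzero multiple of
    [(k n.+1).[y]], which is positive at both roots. As [y - x0] changes sign from [y1] to [y2], so
    does [q n.+1]. *)
Lemma deflated_quo_root (n : nat) (y1 y2 : R) :
  root (p n.+1) y1 -> root (p n.+1) y2 -> y1 < y2 ->
  `|y1 - x0| < d -> `|y2 - x0| < d ->
  exists2 y, y1 < y < y2 & root (q n.+1) y.
Proof.
move=> r1 r2 y12 d1 d2.
have k1 := cd_kernel_root_gt0 r1 d1; have k2 := cd_kernel_root_gt0 r2 d2.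
have surround t : root (p n.+1) t -> y1 < t -> `|t - x0| < d -> y1 < x0 < t.
  move=> rt yt td; have [v vE] := root_factor r1.
  move: rt; rewrite vE rootM root_XsubC gt_eqF //= => /root_factor[u uE].
  by apply: (@roots_surround n.+1 y1 t u) => //; [rewrite vE uE mulrA|exact: ltW].
have /andP[y1x0 x0y2] := surround _ r2 y12 d2.
(* If [x0] were a root, [surround] applied to it would give [x0 < x0]. *)
have px0 : (p n.+1).[x0] != 0.
  apply/negP => /surround/(_ y1x0); rewrite subrr normr0 ltxx andbF.
  by move/(_ d_gt0).
have K0 := cd_kernel_diag_gt0 n.
have qy y : root (p n.+1) y ->
    (y - x0) * (q n.+1).[y] = - ((p n.+1).[x0] / K n.+1) * (k n.+1).[y].
  move=> /rootP ry; have := congr1 (horner^~ y) (deflatedE n).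
  rewrite /= hornerM hornerXsubC => <-.
  by rewrite /s hornerD hornerN hornerZ ry add0r mulNr.
have qq : (q n.+1).[y1] * (q n.+1).[y2] < 0.
  have : 0 < ((y1 - x0) * (q n.+1).[y1]) * ((y2 - x0) * (q n.+1).[y2]).
    rewrite !qy // mulrACA mulr_gt0 //; last exact: mulr_gt0.
    by rewrite mulrNN -expr2 exprn_even_gt0 //= mulf_neq0 ?invr_eq0 // gt_eqF.
  rewrite mulrACA nmulr_rgt0 // nmulr_rlt0 ?subr_lt0 //; lra.
by have [y yin yr] := poly_ivtoo (ltW y12) qq; exists y; rewrite ?in_itv in yin.
Qed.

Lemma L_deflated_ortho (n : nat) (f : {poly R}) :
  (size f <= n.+1)%N -> f.[x0] = 0 -> L (s n.+1 * f) = 0.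
Proof.
move=> sf fx0; rewrite /s mulrBl linearB /= ortho_lt // -scalerAl linearZ /=.
by rewrite cd_kernel_repr // fx0 mulr0 subrr.
Qed.

Lemma L_deflated_eval (n : nat) (f : {poly R}) :
  (size f <= n.+1)%N -> L (s n.+1 * f) = f.[x0] * L (s n.+1).
Proof.
move=> sf; rewrite -[in LHS](subrK f.[x0]%:P f) mulrDr linearD /=.
rewrite L_deflated_ortho ?add0r ?hornerD ?hornerN ?hornerC ?subrr //.
  by rewrite mulrC mul_polyC linearZ.
rewrite size_polyB_le //; exact: leq_trans (size_polyC_leq1 _) _.
Qed.

Lemma L_deflated_sqr (n : nat) :
  L (s n.+1 * s n.+1) = 1 + (p n.+1).[x0] ^+ 2 / K n.+1.
Proof.
set c := (p n.+1).[x0] / K n.+1.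
have K0 : K n.+1 != 0 by rewrite gt_eqF // cd_kernel_diag_gt0.
have -> : s n.+1 * s n.+1 = p n.+1 * p n.+1 - (2 * c) *: (p n.+1 * k n.+1)
    + c ^+ 2 *: (k n.+1 * k n.+1).
  by rewrite /s -/c -!mul_polyC; ring.
rewrite linearD linearB !linearZ /= L_p eqxx ortho_lt ?size_cd_kernel //.
by rewrite L_cd_kernel_sqr /c /=; field.
Qed.

Lemma L_deflated_sqr_ge1 (n : nat) : 1 <= L (s n.+1 * s n.+1).
Proof.
by rewrite L_deflated_sqr lerDl divr_ge0 ?sqr_ge0 // ltW // cd_kernel_diag_gt0.
Qed.

Local Notation C := (m0 * (p 0).[x0] ^+ 2)^-1.

(** The square norm is the quotient [K n.+2 / K n.+1]; the atom bounds its numerator above, and the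
    term of index 0 bounds its denominator below. *)
Lemma L_deflated_sqr_le (n : nat) : L (s n.+1 * s n.+1) <= C.
Proof.
have K0 := cd_kernel_diag_gt0 n; have p0 := p0_sqr_gt0.
rewrite L_deflated_sqr.
have -> : 1 + (p n.+1).[x0] ^+ 2 / K n.+1 = K n.+2 / K n.+1.
  by rewrite (cd_kernel_diagS n.+1); field; rewrite gt_eqF.
rewrite invfM ler_pM ?cd_kernel_diag_le ?invr_ge0 ?(ltW K0) //.
  exact/ltW/cd_kernel_diag_gt0.
by rewrite lef_pV2 ?posrE // cd_kernel_diag_ge.
Qed.

(** * The recurrence and the Christoffel-Darboux formula *)

Variables (a b : nat -> R).
Hypothesis a_gt0 : forall n, 0 < a n.+1.
Hypothesis rec0 : 'X * p 0 = a 1 *: p 1 + b 1 *: p 0.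
Hypothesis recS : forall n,
  'X * p n.+1 = a n.+2 *: p n.+2 + b n.+2 *: p n.+1 + a n.+1 *: p n.

Lemma christoffel_darboux (n : nat) :
  ('X - x0%:P) * k n.+1
  = a n.+1 *: ((p n).[x0] *: p n.+1 - (p n.+1).[x0] *: p n).
Proof.
have recP (c : {poly R}) m : ('X - x0%:P) * (c * p m) = c * ('X * p m) - x0%:P
  * c * p m.
  by ring.
elim: n => [|n IH].
  have r0 : (x0 * (p 0).[x0])%:P = (a 1 * (p 1).[x0] + b 1 * (p 0).[x0])%:P.
    by congr (_%:P); have := congr1 (horner^~ x0) rec0; rewrite /= !hornerE.
  rewrite cd_kernelS /k big_ord0 add0r -!mul_polyC recP rec0 -polyCM r0.
  by rewrite -!mul_polyC; ring.
have rn : (x0 * (p n.+1).[x0])%:P =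
    (a n.+2 * (p n.+2).[x0] + b n.+2 * (p n.+1).[x0] + a n.+1 * (p n).[x0])%:P.
  by congr (_%:P); have := congr1 (horner^~ x0) (recS n); rewrite /= !hornerE.
rewrite cd_kernelS mulrDr IH -!mul_polyC recP recS -polyCM rn.
by rewrite -!mul_polyC; ring.
Qed.

(** * The Wronskian of two consecutive quotients *)

Section Wronskian.
Variable n : nat.

Local Notation t j := (q j).[x0].

Definition wronskian : {poly R} := t n.+1 *: q n.+2 - t n.+2 *: q n.+1.
Local Notation W := wronskian.

Lemma wronskian_x0 : W.[x0] = 0.
Proof. by rewrite /W !hornerE mulrC subrr. Qed.

(** After multiplication by [X - x0] the recurrence cancels the top-degree terms. The polynomial
    also vanishes at [x0], which makes it orthogonal to [s n.+1]. *)
Lemma size_deflated_recurrence :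
  (size (a n.+2 *: (q n.+2 - (t n.+2)%:P) - s n.+1)%R <= n.+1)%N.
Proof.
rewrite -(size_XsubC_mul x0).
have -> : ('X - x0%:P) * (a n.+2 *: (q n.+2 - (t n.+2)%:P) - s n.+1) =
    (a n.+2 *: p n.+2 - 'X * p n.+1)
    - (a n.+2 * ((p n.+2).[x0] / K n.+2)) *: k n.+2
    - (a n.+2 * t n.+2) *: ('X - x0%:P)
    + x0 *: p n.+1
    + ((p n.+1).[x0] / K n.+1) *: (('X - x0%:P) * k n.+1).
  transitivity (a n.+2 *: (('X - x0%:P) * q n.+2)
      - (a n.+2 * t n.+2) *: ('X - x0%:P) - ('X - x0%:P) * s n.+1).
    by rewrite -!mul_polyC; ring.
  by rewrite -deflatedE /s -!mul_polyC; ring.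
rewrite recS; apply: size_polyD_le; last first.
  by rewrite size_polyZ_le // size_XsubC_mul size_cd_kernel.
apply: size_polyD_le; last by rewrite size_polyZ_le // size_p.
apply: size_polyB_le; last by rewrite size_polyZ_le // size_XsubC.
apply: size_polyB_le; last by rewrite size_polyZ_le // size_cd_kernel.
rewrite opprD opprD !addrA subrr add0r -opprD size_polyN.
by rewrite size_polyD_le // size_polyZ_le ?size_p // leqW // size_p.
Qed.

(** [q n.+2 * s n.+1] and [q n.+1 * s n.+2] are the same polynomial, so [L_deflated_eval] evaluates
    the mixed term; the rest is the orthogonality of [s n.+1] to the polynomial of
    [size_deflated_recurrence]. *)
Lemma wronskian_value :
  a n.+2 * (t n.+1 * L (s n.+2) - t n.+2 * L (s n.+1)) = L (s n.+1 * s n.+1).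
Proof.
have sq := size_deflated_quo n.
have e1 : L (q n.+2 * s n.+1) = t n.+1 * L (s n.+2).
  by rewrite -(L_deflated_eval (leqW sq)) !deflatedE; congr (L _); ring.
have := L_deflated_ortho size_deflated_recurrence.
rewrite hornerD hornerN hornerZ hornerD hornerN hornerC subrr mulr0.
rewrite deflated_x0 subrr => /(_ erefl).
have -> : s n.+1 * (a n.+2 *: (q n.+2 - (t n.+2)%:P) - s n.+1) =
    a n.+2 *: (q n.+2 * s n.+1) - (a n.+2 * t n.+2) *: s n.+1 - s n.+1 * s n.+1.
  by rewrite -!mul_polyC; ring.
rewrite linearB linearB ![L (_ *: _)]linearZ /= e1 => /eqP.
by rewrite subr_eq0 => /eqP <-; ring.
Qed.

Local Notation E := (L (s n.+1 * s n.+1) / a n.+2).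

Lemma L_wronskian (f : {poly R}) : (size f <= n.+1)%N ->
  L (W * (('X - x0%:P) * f)) = E * f.[x0].
Proof.
move=> sf.
have -> : W * (('X - x0%:P) * f) = t n.+1 *: (s n.+2 * f) - t n.+2 *: (s n.+1 *
  f).
  by rewrite !deflatedE /W -!mul_polyC; ring.
rewrite linearB ![L (_ *: _)]linearZ /= (L_deflated_eval sf) (L_deflated_eval
  (leqW sf)) -wronskian_value.
by field; rewrite gt_eqF.
Qed.

(** [W] vanishes at [x0], and [d <= |x - x0|] on the rest of the support, so multiplying [W] by
    [X - x0] enlarges its norm by a factor of at least [d]. The product is a combination of the
    orthogonal [s n.+1] and [s n.+2]. *)
Lemma wronskian_bound : d ^+ 2 * L (W * W) <= C * (t n.+1 ^+ 2 + t n.+2 ^+ 2).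
Proof.
have tail : 0 <= L ((('X - x0%:P) ^+ 2 - (d ^+ 2)%:P) * (W * W)).
  apply: L_ge0 => x xS; rewrite hornerM [(W * W).[x]]hornerM -expr2.
  rewrite hornerD hornerN hornerC horner_exp hornerXsubC.
  case: xS => [->|xd]; first by rewrite wronskian_x0 expr0n mulr0.
  rewrite mulr_ge0 ?sqr_ge0 // subr_ge0 -[leRHS]real_normK ?num_real //.
  by rewrite lerXn2r ?nnegrE // ltW.
have XW : ('X - x0%:P) * W = t n.+1 *: s n.+2 - t n.+2 *: s n.+1.
  by rewrite !deflatedE /W -!mul_polyC; ring.
have ss : L (s n.+2 * s n.+1) = 0.
  by apply: L_deflated_ortho; [exact: size_deflated|exact: deflated_x0].
move: tail.
have -> : (('X - x0%:P) ^+ 2 - (d ^+ 2)%:P) * (W * W) =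
    (('X - x0%:P) * W) * (('X - x0%:P) * W) - (d ^+ 2) *: (W * W).
  by rewrite -mul_polyC; ring.
rewrite linearB [L (_ *: _)]linearZ /= subr_ge0 XW => /le_trans; apply.
have -> : (t n.+1 *: s n.+2 - t n.+2 *: s n.+1) * (t n.+1 *: s n.+2 - t n.+2 *:
  s n.+1) =
    t n.+1 ^+ 2 *: (s n.+2 * s n.+2) - (2 * t n.+1 * t n.+2) *: (s n.+2 * s n.+1)
    + t n.+2 ^+ 2 *: (s n.+1 * s n.+1).
  by rewrite -!mul_polyC; ring.
rewrite linearD linearB ![L (_ *: _)]linearZ /= ss mulr0 subr0 [leRHS]mulrC
  [leRHS]mulrDl.
by rewrite lerD // ler_wpM2l ?sqr_ge0 ?L_deflated_sqr_le.
Qed.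

(** With [q m.+1 = ('X - y%:P) * g], the value at [x0] is [(x0 - y) * g.[x0]], and [E * g.[x0]] is
    the pairing of [W] with [f = ('X - x0%:P) * g], to which Cauchy-Schwarz applies. *)
Lemma deflated_quo_root_bound (m : nat) (y r : R) : (m <= n.+1)%N ->
  root (q m.+1) y -> `|y - x0| <= r -> r < d ->
  (d - r) ^+ 2 * t m.+1 ^+ 2 <= r ^+ 2 * a n.+2 ^+ 2 * C * L (W * W).
Proof.
move=> mn /root_factor[g qE] yr rd.
pose f := ('X - x0%:P) * g.
have sg : (size g <= m)%N.
  by rewrite -(size_XsubC_mul y) -qE size_deflated_quo.
have tE : t m.+1 = (x0 - y) * g.[x0] by rewrite qE hornerM hornerXsubC.
have := @scalar_CauchySchwarz R L 1 _ W f.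
rewrite !mul1r L_wronskian ?(leq_trans sg) // => CS.
have {CS}: (E * g.[x0]) ^+ 2 <= L (W * W) * L (f * f).
  by apply: CS => h; rewrite mul1r L_sqr_ge0.
have sE : s m.+1 = ('X - y%:P) * f by rewrite deflatedE qE /f; ring.
(* [f] vanishes at [x0], and elsewhere on the support [|x - y| >= d - r], so [f] is controlled by
   [s m.+1 = ('X - y%:P) * f]. *)
have fC : (d - r) ^+ 2 * L (f * f) <= C.
  apply: le_trans (L_deflated_sqr_le m).
  rewrite -subr_ge0 -linearZ -linearB /=.
  have -> : s m.+1 * s m.+1 - (d - r) ^+ 2 *: (f * f) =
      (('X - y%:P) ^+ 2 - ((d - r) ^+ 2)%:P) * (f * f).
    by rewrite sE -mul_polyC; ring.
  apply: L_ge0 => x xS; rewrite hornerM [(f * f).[x]]hornerM -expr2.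
  rewrite hornerD hornerN hornerC horner_exp hornerXsubC.
  case: xS => [->|xd]; first by rewrite hornerM hornerXsubC subrr mul0r expr0n
    mulr0.
  rewrite mulr_ge0 ?sqr_ge0 // subr_ge0 -[leRHS]real_normK ?num_real //.
  rewrite lerXn2r ?nnegrE ?subr_ge0 ?(ltW rd) // lerBlDr.
  by rewrite (le_trans xd) // -(subrKA y) (le_trans (ler_normD _ _)) // lerD.
have a2 : 1 <= a n.+2 ^+ 2 * E ^+ 2.
  by rewrite -exprMn mulrCA divff ?gt_eqF // mulr1 exprn_ege1 //
    L_deflated_sqr_ge1.
move=> CS; rewrite tE exprMn.
have yr2 : (x0 - y) ^+ 2 <= r ^+ 2.
  by rewrite -[leLHS]real_normK ?num_real // distrC lerXn2r ?nnegrE //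
    (le_trans _ yr).
apply: (@le_trans _ _ ((d - r) ^+ 2 * (r ^+ 2 * (a n.+2 ^+ 2 * (E * g.[x0]) ^+
  2)))).
  rewrite ler_wpM2l ?sqr_ge0 // ler_pM ?sqr_ge0 // exprMn mulrA.
  by rewrite ler_peMl ?sqr_ge0.
set Y := (E * g.[x0]) ^+ 2 in CS *.
have YC : (d - r) ^+ 2 * Y <= C * L (W * W).
  apply: (@le_trans _ _ ((d - r) ^+ 2 * (L (W * W) * L (f * f)))).
    by rewrite ler_wpM2l ?sqr_ge0.
  by rewrite mulrCA mulrC ler_wpM2r // L_sqr_ge0.
rewrite (_ : (d - r) ^+ 2 * _ = r ^+ 2 * a n.+2 ^+ 2 * ((d - r) ^+ 2 * Y));
  last by ring.
by rewrite -[leRHS]mulrA ler_wpM2l // mulr_ge0 ?sqr_ge0.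
Qed.

Lemma wronskian_neq0 : W != 0.
Proof.
apply/eqP => W0; have s1 : (size (1%R : {poly R}) <= n.+1)%N by rewrite
  size_poly1.
have := L_wronskian s1; rewrite W0 mul0r linear0 hornerC mulr1 => /eqP.
rewrite eq_sym mulf_eq0 invr_eq0 [a _ == 0]gt_eqF // orbF => /eqP ss0.
by have := L_deflated_sqr_ge1 n; rewrite ss0 ler10.
Qed.

Lemma deflated_quo_close_roots_le (y z r : R) :
  root (q n.+1) y -> root (q n.+2) z ->
  `|y - x0| <= r -> `|z - x0| <= r -> r < d ->
  d * (d - r) <= Num.sqrt 2 * C * a n.+2 * r.
Proof.
move=> qy qz yr zr rd.
have r0 : 0 <= r by exact: le_trans yr.
have C0 : 0 <= C by rewrite (le_trans _ (L_deflated_sqr_le n)) // L_sqr_ge0.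
have b1 := deflated_quo_root_bound (leqnSn n) qy yr rd.
have b2 := deflated_quo_root_bound (leqnn n.+1) qz zr rd.
have bW := wronskian_bound; have LW := L_sqr_gt0 wronskian_neq0.
(* The two root bounds are added, [wronskian_bound] bounds the result from the other side, and the
   positive [L (W * W)] cancels. The sum of two equal bounds produces the factor [Num.sqrt 2]. *)
have le2 : (d * (d - r)) ^+ 2 <= (Num.sqrt 2 * C * a n.+2 * r) ^+ 2.
  rewrite -(ler_pM2r LW) !exprMn sqr_sqrtr //.
  set M := L (W * W) in b1 b2 bW *; set c := C in b1 b2 bW C0 *.
  apply: (@le_trans _ _ ((d - r) ^+ 2 * (c * (t n.+1 ^+ 2 + t n.+2 ^+ 2)))).
    by rewrite -mulrA mulrCA ler_wpM2l ?sqr_ge0.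
  rewrite mulrCA [(d - r) ^+ 2 * _]mulrDr.
  apply: (le_trans (ler_wpM2l C0 (lerD b1 b2))).
  by rewrite (_ : c * _ = 2 * c ^+ 2 * a n.+2 ^+ 2 * r ^+ 2 * M) //; ring.
by move: le2; rewrite ler_sqr // nnegrE !mulr_ge0 ?sqrtr_ge0 ?subr_ge0 // ltW.
Qed.

End Wronskian.

(** * Simple real roots and Gauss quadrature *)

Lemma real_simple_roots (n : nat) :
  exists2 s : seq R, uniq s && all (root (p n)) s & size s = n.
Proof.
have pn0 : p n != 0 by rewrite -size_poly_eq0 size_p.
have [s /andP[us rs] [c c0 cs]] := sign_changes pn0.
exists s; rewrite ?us //.
have le_sn : (size s <= n)%N.
  by rewrite -ltnS -(size_p n); exact: max_poly_roots.
apply/eqP; rewrite eqn_leq le_sn leqNgt; apply/negP => lt_sn.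
(* With fewer than [n] sign changes, [p n * P] would have constant sign although [p n] is orthogonal
   to [P]. *)
set P := \prod_(y <- s) ('X - y%:P) in cs.
have P0 : P != 0 by rewrite monic_neq0 // monic_prod_XsubC.
have /eqP : c *: (p n * P) = 0.
  apply: L_ge0_eq0 => [x _|]; first by rewrite hornerZ.
  by rewrite linearZ /= ortho_lt ?mulr0 // size_prod_XsubC.
by rewrite scaler_eq0 !mulf_eq0 (negPf c0) (negPf pn0) (negPf P0).
Qed.

(* The Gauss quadrature weights are [L (v ^ 2) / v(y) ^ 2] where
   [v = p n / (X - y)]. *)
Lemma gauss_quadrature_ge0 (n : nat) (f : {poly R}) : (size f <= n + n)%N ->
  (forall y, root (p n) y -> 0 <= f.[y]) -> 0 <= L f.
Proof.
move=> sf f_ge0; have pn0 : p n != 0 by rewrite -size_poly_eq0 size_p.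
have [s /andP[us /allP rs] sn] := real_simple_roots n.
pose v y := p n %/ ('X - y%:P).
have vE y : y \in s -> p n = ('X - y%:P) * v y.
  by move=> ys; rewrite mulrC divpK // dvdp_XsubCl rs.
have sv y : y \in s -> (size (v y) <= n)%N.
  by move=> ys; rewrite -(size_XsubC_mul y) -vE // size_p.
have vz y z : y \in s -> z \in s -> z != y -> (v y).[z] = 0.
  move=> ys zs zy; have := rs z zs.
  by rewrite (vE y ys) rootM root_XsubC (negPf zy) => /rootP.
have zero_on (g : {poly R}) : (size g <= n)%N -> (forall z, z \in s -> g.[z] =
  0) -> g = 0.
  move=> sg gs; apply/eqP/negPn/negP => g0.
  have rg : all (root g) s by apply/allP => z /gs/rootP.
  by have := max_poly_roots g0 rg us; rewrite sn ltnNge sg.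
have vy y : y \in s -> (v y).[y] != 0.
  move=> ys; apply/eqP => vyy.
  have v0 : v y = 0.
    apply: zero_on => [|z zs]; first exact: sv.
    by have [->|zy] := eqVneq z y; [|exact: vz].
  by move: pn0; rewrite (vE y ys) v0 mulr0 eqxx.
(* Only the remainder modulo [p n] contributes: the quotient has size at most [n], so [p n] is
   orthogonal to it. *)
pose r := f %% p n.
have sr : (size r <= n)%N by rewrite -ltnS -(size_p n) ltn_modp.
have rf z : z \in s -> r.[z] = f.[z].
  move=> /rs/rootP pz; rewrite [in RHS](divp_eq f (p n)) hornerD hornerM pz.
  by rewrite mulr0 add0r.
have Lr : L f = L r.
  rewrite [in LHS](divp_eq f (p n)) linearD /= mulrC ortho_lt ?add0r //.
  by rewrite size_divp // size_p /= leq_subLR.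
(* Lagrange interpolation at the roots of [p n]. *)
have rE : r = \sum_(y <- s) (r.[y] / (v y).[y]) *: v y.
  apply/eqP; rewrite -subr_eq0; apply/eqP/zero_on.
    rewrite size_polyB_le // big_seq; apply: (leq_trans (size_sum _ _ _)).
    by apply/bigmax_leqP_seq => y _ ys; rewrite size_polyZ_le // sv.
  move=> z zs; rewrite hornerD hornerN horner_sum (bigD1_seq z) //=
    big_seq_cond big1.
    by rewrite hornerZ divfK ?vy // addr0 subrr.
  by move=> y /andP[ys yz]; rewrite hornerZ (vz y z) ?mulr0 1?eq_sym.
rewrite Lr rE linear_sum /= big_seq; apply: sumr_ge0 => y ys.
have Lvv := L_cofactor_root (vE y ys) (sv y ys).
rewrite linearZ /= (_ : L (v y) = L (v y * v y) / (v y).[y]); last first.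
  by rewrite Lvv mulrAC divff ?vy // mul1r.
rewrite mulf_div -expr2.
by rewrite rf // divr_ge0 ?sqr_ge0 // mulr_ge0 ?L_sqr_ge0 // f_ge0 // rs.
Qed.

(** Quadrature at the roots of [p n.+1] is applied to [c *: (p n * p n) - r ^+ 2 *: (k n.+1 * k
    n.+1)]. At such a root [y], Christoffel-Darboux turns the first term into [((y - x0) * (k
    n.+1).[y]) ^+ 2]. *)
Lemma no_close_root_le (n : nat) (r : R) :
  (forall y, root (p n.+1) y -> r <= `|y - x0|) -> 0 <= r ->
  r ^+ 2 * (p 0).[x0] ^+ 2 <= a n.+1 ^+ 2 * (p n.+1).[x0] ^+ 2.
Proof.
move=> far r0; set c := a n.+1 ^+ 2 * _.
apply: (@le_trans _ _ (r ^+ 2 * K n.+1)).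
  by rewrite ler_wpM2l ?sqr_ge0 ?cd_kernel_diag_ge.
rewrite -subr_ge0 -[c]mulr1 -(_ : L (p n * p n) = 1); last by rewrite L_p eqxx.
rewrite -L_cd_kernel_sqr.
rewrite (_ : _ - _ = L (c *: (p n * p n) - r ^+ 2 *: (k n.+1 * k n.+1))); last
  first.
  by rewrite linearB !linearZ.
apply: (@gauss_quadrature_ge0 n.+1) => [|y ry].
  rewrite size_polyB_le // size_polyZ_le //.
    by rewrite (leq_trans (size_polyMleq _ _)) // (leq_trans (leq_pred _)) //
      size_p.
  rewrite (leq_trans (size_polyMleq _ _)) // (leq_trans (leq_pred _)) //.
  by rewrite leq_add // size_cd_kernel.
have := congr1 (horner^~ y) (christoffel_darboux n); rewrite /=.
rewrite hornerM hornerXsubC hornerZ hornerD hornerN !hornerZ (rootP ry) mulr0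
  sub0r => cd.
rewrite hornerD hornerN !hornerZ [(p n * p n).[y]]hornerM [(k n.+1 * k
  n.+1).[y]]hornerM.
rewrite (_ : c * _ = ((y - x0) * (k n.+1).[y]) ^+ 2); last by rewrite cd /c; ring.
rewrite -expr2 exprMn -mulrBl mulr_ge0 ?sqr_ge0 // subr_ge0.
by rewrite -[leRHS]real_normK ?num_real // lerXn2r ?nnegrE ?far.
Qed.

Lemma two_close_roots_le (n : nat) (y1 y2 z1 z2 r : R) :
  root (p n.+1) y1 -> root (p n.+1) y2 -> y1 < y2 ->
  root (p n.+2) z1 -> root (p n.+2) z2 -> z1 < z2 ->
  `|y1 - x0| < r -> `|y2 - x0| < r -> `|z1 - x0| < r -> `|z2 - x0| < r ->
  r < d -> d * (d - r) <= Num.sqrt 2 * C * a n.+2 * r.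
Proof.
move=> ry1 ry2 y12 rz1 rz2 z12 y1r y2r z1r z2r rd.
have [y yin ry] := deflated_quo_root ry1 ry2 y12 (lt_trans y1r rd) (lt_trans
  y2r rd).
have [z zin rz] := deflated_quo_root rz1 rz2 z12 (lt_trans z1r rd) (lt_trans
  z2r rd).
apply: (deflated_quo_close_roots_le ry rz) => //.
  by move: yin y1r y2r; rewrite !ltr_norml ler_norml; lra.
by move: zin z1r z2r; rewrite !ltr_norml ler_norml; lra.
Qed.

End Orthonormal.

(** * The support of the measure and its isolated points *)

Section Support.
Variables (R : realType) (mu : {measure set (measurableTypeR R) -> \bar R}).

(** Every point off the support lies in a null interval with rational endpoints, and there are
    countably many of these. Codes [k] of no null interval are sent to the empty set. *)
Lemma negligible_setC_msupp : mu.-negligible (~` msupp mu).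
Proof.
pose I (q : rat * rat) : set (measurableTypeR R) := `]ratr q.1, ratr q.2[%classic.
pose F (k : nat) : set (measurableTypeR R) := if choice.unpickle k is Some q then
  if mu (I q) == 0%E then I q else set0 else set0.
apply: (@negligibleS _ _ _ _ (\bigcup_k F k)) => [x|]; last first.
  apply: negligible_bigcup => k; rewrite /F.
  case: (choice.unpickle k) => [q|]; last exact: negligible_set0.
  case: ifPn => [/eqP q0|_]; last exact: negligible_set0.
  by apply/negligibleP => //; exact: measurable_itv.
move=> /existsNP[U] /not_implyP[oU] /not_implyP[Ux] /negP.
rewrite -leNgt => muU.
have /nbhs_ballP[e /= e0 eU] : nbhs x U by exact: open_nbhs_nbhs.
have /rat_in_itvoo[q1] : x - e < x by rewrite ltrBlDr ltrDl.
rewrite in_itv /= => /andP[xq1 q1x].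
have /rat_in_itvoo[q2] : x < x + e by rewrite ltrDl.
rewrite in_itv /= => /andP[xq2 q2x].
have [k kE] : exists k, choice.unpickle k = Some (q1, q2).
  by exists (choice.pickle (q1, q2)); rewrite choice.pickleK.
exists k => //; rewrite /F kE.
have IU : I (q1, q2) `<=` U.
  move=> y; rewrite /I /= in_itv /= => /andP[qy yq]; apply: eU.
  by rewrite /ball /= ltr_norml; apply/andP; split; lra.
have -> : mu (I (q1, q2)) == 0%E.
  rewrite eq_le measure_ge0 andbT (le_trans _ muU) // le_measure ?inE //.
    exact: measurable_itv.
  exact: open_measurable.
by rewrite /I /= in_itv /= q1x xq2.
Qed.

Lemma isolated_msupp_gap (x0 : R) : isolated (msupp mu) x0 ->
  exists2 d, 0 < d & forall x, msupp mu x -> x = x0 \/ d <= `|x - x0|.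
Proof.
move=> [_ [V /nbhs_ballP[d /= d0 dV] Vx0]]; exists d => // x xS.
have [xd|] := ltP `|x - x0| d; last by right.
left; suff : [set x0] x by [].
by rewrite -Vx0; split => //; apply: dV; rewrite /ball /= distrC.
Qed.

(** A small ball around [x0] has positive measure, while the ball without [x0] misses the support
    and is null. *)
Lemma isolated_msupp_gt0 (x0 : R) :
  isolated (msupp mu) x0 -> (0 < mu [set x0])%E.
Proof.
move=> iso; have [d d0 gap] := isolated_msupp_gap iso.
have /set_mem x0S := iso.1.
have oB : open (ball x0 d) by exact: ball_open.
have := x0S _ oB (ballxx x0 d0).
have mx0 : measurable ([set x0] : set (measurableTypeR R))
  by exact: measurable_set1.
have mB : measurable (ball x0 d : set (measurableTypeR R))
  by exact: open_measurable.
have mBx : measurable (ball x0 d `\ x0 : set (measurableTypeR R))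
  by exact: measurableD.
have -> : ball x0 d = [set x0] `|` (ball x0 d `\ x0) :> set (measurableTypeR R).
  apply/seteqP; split => x /=.
    by have [->|/eqP xx0] := eqVneq x x0; [left|right].
  by case=> [->|[]//]; exact: ballxx.
rewrite measureU //; last by apply/seteqP; split => x //= [-> [_ /(_ erefl)]].
rewrite [X in (_ + X)%R](_ : _ = 0%E) ?addr0 //.
apply/negligibleP => //; apply: negligibleS negligible_setC_msupp.
move=> x [/= xd xx0] /gap[//|]; rewrite leNgt => /negP; apply.
by rewrite distrC.
Qed.

End Support.

(** * Integration of polynomials as a linear functional *)

Section Moments.
Variables (R : realType) (mu : {measure set (measurableTypeR R) -> \bar R}).
Hypothesis mu_moments : finite_moments mu.

Lemma measurable_horner (f : {poly R}) :
  measurable_fun [set: measurableTypeR R] (horner f).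
Proof. by apply: continuous_measurable_fun; exact: continuous_horner. Qed.

Lemma integrable_horner (f : {poly R}) :
  mu.-integrable [set: measurableTypeR R] (EFin \o horner f).
Proof.
have -> : EFin \o horner f =
    (fun x => \sum_(i < size f) (f`_i)%:E * (x ^+ i)%:E)%E.
  by apply/funext => x /=; rewrite horner_coef -sumEFin.
apply: integrable_sum => // i _; apply: integrableZl => //; apply/integrableP;
  split.
  apply/measurable_EFinP; exact: measurable_funX.
by under eq_integral do rewrite /= normrX.
Qed.

Definition moment_functional (f : {poly R}) : R := \int[mu]_x f.[x].

Lemma moment_functional_is_linear : scalar moment_functional.
Proof.
move=> c f g; rewrite /moment_functional.
under eq_Rintegral do rewrite hornerD hornerZ.
rewrite RintegralD //; last 2 first.
- exact: (integrableZl _ _ (integrable_horner f)).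
- exact: integrable_horner.
by rewrite RintegralZl //; exact: integrable_horner.
Qed.

Lemma moment_functional_ge0 (f : {poly R}) :
  (forall x, msupp mu x -> 0 <= f.[x]) -> 0 <= moment_functional f.
Proof.
move=> f_ge0; rewrite /moment_functional /Rintegral fine_ge0 //.
(* [f] may be negative off the support, but there it differs from its absolute value only on a null
   set. *)
have -> : (\int[mu]_x (f.[x])%:E = \int[mu]_x `|f.[x]|%:E)%E.
  apply: ae_eq_integral => //.
  - by apply/measurable_EFinP; exact: measurable_horner.
  - apply/measurable_EFinP; apply: measurableT_comp => //.
    exact: measurable_horner.
  apply: negligibleS (negligible_setC_msupp mu) => x /= /not_implyP[_ fx] xS.
  by apply: fx; rewrite ger0_norm ?f_ge0.
by apply: integral_ge0 => x _; rewrite lee_fin.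
Qed.

Lemma measure_fin_num (A : set (measurableTypeR R)) :
  measurable A -> mu A \is a fin_num.
Proof.
move=> mA; rewrite ge0_fin_numE ?measure_ge0 //.
rewrite (@le_lt_trans _ _ (mu setT)) ?le_measure ?inE //.
have := mu_moments 0%N; under eq_integral do rewrite expr0.
by rewrite integral_cst // mul1e.
Qed.

(** The square of [f] dominates [f.[x0] ^+ 2] times the indicator of [[set x0]]. *)
Lemma moment_functional_mass (x0 : R) (f : {poly R}) :
  fine (mu [set x0]) * f.[x0] ^+ 2 <= moment_functional (f * f).
Proof.
have mx0 : measurable ([set x0] : set (measurableTypeR R))
  by exact: measurable_set1.
rewrite -lee_fin EFinM fineK ?measure_fin_num // /moment_functional.
rewrite /Rintegral fineK; last exact: integrable_fin_num (integrable_horner _).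
rewrite -[mu _]/(mu [set x0]) -[X in mu X]setIT -integral_indic // muleC.
rewrite -ge0_integralZl_EFin ?sqr_ge0 //; last exact/measurable_EFinP.
apply: ge0_le_integral => //.
- by move=> x _; rewrite -EFinM lee_fin mulr_ge0 ?sqr_ge0.
- by apply: measurable_funeM; exact/measurable_EFinP.
- by apply/measurable_EFinP; exact: measurable_horner.
move=> x _; rewrite -EFinM lee_fin indicE hornerM -expr2.
have [|_] := boolP (x \in _); last by rewrite mulr0 sqr_ge0.
by rewrite inE /= => ->; rewrite mulr1.
Qed.

End Moments.

(** * Counting roots in an interval around [x0] *)

Section CountRoots.
Variables (R : realType) (f : {poly R}) (x0 : R).
Hypothesis f0 : f != 0.

Lemma nzerosE (r : R) : nzeros f x0 r = size (roots f (x0 - r) (x0 + r)).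
Proof.
set s := roots _ _ _; rewrite /nzeros.
have -> : [set x | root f x /\ x0 - r < x < x0 + r] = [set` [fset x in s]%fset].
  apply/seteqP; split => x /=; rewrite inE /= in_roots in_itv /= f0 andbT.
    by case=> -> ->.
  by case/andP.
by rewrite set_fsetK card_fseq undup_id ?uniq_roots.
Qed.

Lemma nzeros_ge2 (r : R) : (1 < nzeros f x0 r)%N ->
  exists y1 y2, [/\ root f y1, root f y2, y1 < y2, `|y1 - x0| < r & `|y2 - x0|
    < r].
Proof.
rewrite nzerosE; set s := roots _ _ _ => ss.
have sP y : y \in s -> root f y /\ `|y - x0| < r.
  by rewrite in_roots in_itv /= => /and3P[? /andP[? ?] _]; split=> //;
     rewrite ltr_norml; apply/andP; split; lra.
have := sorted_roots (x0 - r) (x0 + r) f; rewrite -/s.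
case: s ss sP => [//|y1 [//|y2 s]] _ sP /= /andP[y12 _].
have [r1 d1] := sP y1 (mem_head _ _).
have [r2 d2] : root f y2 /\ `|y2 - x0| < r by apply: sP; rewrite !inE eqxx orbT.
by exists y1, y2.
Qed.

Lemma nzeros_eq0 (r : R) : nzeros f x0 r = 0%N ->
  forall y, root f y -> r <= `|y - x0|.
Proof.
rewrite nzerosE => /size0nil/(roots_nil f0) nr y fy; rewrite leNgt.
apply/negP; rewrite ltr_norml => /andP[? ?].
have /nr : y \in `](x0 - r), (x0 + r)[ by rewrite in_itv /=; apply/andP; split;
  lra.
by rewrite fy.
Qed.

Lemma nzeros_le (r r' : R) : r <= r' -> (nzeros f x0 r <= nzeros f x0 r')%N.
Proof.
move=> rr'; rewrite !nzerosE uniq_leq_size ?uniq_roots // => y.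
rewrite in_roots in_itv /= => /and3P[fy /andP[? ?] _].
by rewrite in_roots in_itv /= fy f0 andbT; apply/andP; split; lra.
Qed.

End CountRoots.

(** * Estimates for the radius *)

Section DeltaOf.
Variables (R : realType) (d a : R).
Hypotheses (d_gt0 : 0 < d) (a_ge0 : 0 <= a).

Lemma delta_of_den_gt0 : 0 < d + Num.sqrt 2 * a.
Proof. by rewrite ltr_pwDl // mulr_ge0 // sqrtr_ge0. Qed.

Lemma delta_of_gt0 : 0 < delta_of d a.
Proof. by rewrite divr_gt0 ?exprn_gt0 // delta_of_den_gt0. Qed.

Lemma delta_of_le (a' : R) : a <= a' -> delta_of d a' <= delta_of d a.
Proof.
move=> aa'; have den := delta_of_den_gt0.
have le_den : d + Num.sqrt 2 * a <= d + Num.sqrt 2 * a'.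
  by rewrite lerD2l ler_wpM2l // sqrtr_ge0.
by rewrite ler_wpM2l ?sqr_ge0 // lef_pV2 ?posrE // (lt_le_trans den).
Qed.

(** The radius is at most [d], so [d' = 2 * c * d] leaves [d' - delta_of d a >= c * d]. The second
    inequality is the strict opposite of the conclusion of [two_close_roots_le]. *)
Lemma delta_of_small (d' c : R) : 1 <= c -> d' = 2 * c * d ->
  delta_of d a < d' /\
  Num.sqrt 2 * c * a * delta_of d a < d' * (d' - delta_of d a).
Proof.
move=> c1 d'E; have den := delta_of_den_gt0; have del0 := delta_of_gt0.
have delE : delta_of d a * (d + Num.sqrt 2 * a) = d ^+ 2 by rewrite divfK ?gt_eqF.
set x := delta_of d a in del0 delE *.
have A0 : 0 <= Num.sqrt 2 * a by rewrite mulr_ge0 ?sqrtr_ge0.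
rewrite (_ : Num.sqrt 2 * c * a = c * (Num.sqrt 2 * a)); last by ring.
set A := Num.sqrt 2 * a in A0 delE *.
have xA : 0 <= x * A by rewrite mulr_ge0 // ltW.
have xd : x <= d.
  by rewrite -(ler_pM2r d_gt0) -expr2 -delE; nra.
have cd : d <= c * d by rewrite ler_peMl // ltW.
split; first by rewrite d'E -mulrA; lra.
have xA_le : x * A <= d ^+ 2 by rewrite -delE mulrDr lerDr mulr_ge0 // ltW.
have cxA : c * (x * A) <= c * d ^+ 2 by rewrite ler_wpM2l // (le_trans _ c1).
have ge1 : c * d <= d' - x by rewrite d'E -mulrA; lra.
have cd0 : 0 < c * d by exact: lt_le_trans cd.
apply: (@le_lt_trans _ _ (c * d ^+ 2)).
  by rewrite (_ : c * A * x = c * (x * A)) //; ring.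
apply: (@lt_le_trans _ _ (d' * (c * d))); last by rewrite ler_pM2l // d'E
  -mulrA; lra.
rewrite d'E expr2 mulrA [_ * (c * d)]mulrC ltr_pM2l //; lra.
Qed.

End DeltaOf.

(** * Transfer to the measure and choice of [d0] *)

Theorem theorem2 (R : realType)
    (mu : {measure set (measurableTypeR R) -> \bar R})
    (mu_moments : finite_moments mu)
    (mu_infinite : ~ finite_set (msupp mu))
    (p : nat -> {poly R}) (p_orthonormal : orthonormal_polys mu p)
    (a b : nat -> R) (ab_rec : recursion_coefs p a b)
    (x0 : R) (x0_isolated : isolated (msupp mu) x0) :
  exists2 d0 : R, 0 < d0 &
    (forall n : nat,
       (nzeros (p n) x0 (delta_of d0 (a n.+1)) <= 1)%N \/
       (nzeros (p n.+1) x0 (delta_of d0 (a n.+1)) <= 1)%N) /\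
    (has_ubound (range (fun n : nat => a n.+1)) ->
     let a_infty : R := sup (range (fun n : nat => a n.+1)) in
     let delta_infty : R := delta_of d0 a_infty in
     \forall n \near \oo,
       nzeros (p n) x0 delta_infty = 1%N \/
       nzeros (p n.+1) x0 delta_infty = 1%N).
Proof.
have [size_p _ int_p] := p_orthonormal; have [a_gt0 rec0 recS] := ab_rec.
have [d d_gt0 gap] := isolated_msupp_gap x0_isolated.
pose m0 := fine (mu [set x0]).
have m0_gt0 : 0 < m0.
  have mx0 : measurable ([set x0] : set (measurableTypeR R))
    by exact: measurable_set1.
  rewrite fine_gt0 // isolated_msupp_gt0 //= -ge0_fin_numE ?measure_ge0 //.
  exact: measure_fin_num.
pose L : {scalar {poly R}} := HB.pack (moment_functional mu)
  (GRing.isLinear.Build R {poly R} R _ _ (moment_functional_is_linear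
    mu_moments)).
have L_p n m : L (p n * p m) = (n == m)%:R.
  rewrite /L /= /moment_functional /Rintegral.
  by under eq_integral do rewrite hornerM; rewrite int_p.
have L_ge0 (f : {poly R}) :
    (forall x, x = x0 \/ d <= `|x - x0| -> 0 <= f.[x]) -> 0 <= L f.
  by move=> f_ge0; apply: moment_functional_ge0 => // x /gap/f_ge0.
have L_mass (f : {poly R}) : m0 * f.[x0] ^+ 2 <= L (f * f).
  exact: moment_functional_mass.
pose c := (m0 * (p 0%N).[x0] ^+ 2)^-1.
have c_ge1 : 1 <= c.
  apply: le_trans (L_deflated_sqr_ge1 size_p L_p x0 0) _.
  exact: (L_deflated_sqr_le size_p L_p).
have c_gt0 : 0 < c by exact: lt_le_trans c_ge1.
pose d0 := d / (2 * c).
have d0_gt0 : 0 < d0 by rewrite divr_gt0 // mulr_gt0.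
have dE : d = 2 * c * d0 by rewrite /d0 mulrC divfK // mulf_neq0 ?gt_eqF.
have p_neq0 n : p n != 0 by rewrite -size_poly_eq0 size_p.
have le1 n : (nzeros (p n) x0 (delta_of d0 (a n.+1)) <= 1)%N \/
    (nzeros (p n.+1) x0 (delta_of d0 (a n.+1)) <= 1)%N.
  (* Index 0 is separate because the deflation argument starts at index 1; [p 0] is a nonzero
     constant. *)
  case: n => [|n].
    left; rewrite leqNgt; apply/negP => /(nzeros_ge2 (p_neq0 0%N)).
    by move=> [y [_ [/(root_size_gt1 (p_neq0 0%N)) + _ _ _ _]]]; rewrite size_p.
  have [?|gt1] := leqP (nzeros (p n.+1) x0 (delta_of d0 (a n.+2))) 1; first by
    left.
  right; rewrite leqNgt; apply/negP => gt1'.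
  have [y1 [y2 [ry1 ry2 y12 dy1 dy2]]] := nzeros_ge2 (p_neq0 _) gt1.
  have [z1 [z2 [rz1 rz2 z12 dz1 dz2]]] := nzeros_ge2 (p_neq0 _) gt1'.
  have [lt_d far] := delta_of_small d0_gt0 (ltW (a_gt0 n.+1)) c_ge1 dE.
  have := two_close_roots_le size_p L_p d_gt0 m0_gt0 L_ge0 L_mass a_gt0 recS
    ry1 ry2 y12 rz1 rz2 z12 dy1 dy2 dz1 dz2 lt_d.
  by rewrite leNgt far.
exists d0 => //; split=> // a_bnd a_infty delta_infty.
have a_le n : a n.+1 <= a_infty by apply: ub_le_sup => //; exists n.
have ai_gt0 : 0 < a_infty by exact: lt_le_trans (a_gt0 0%N) (a_le 0%N).
have di_gt0 : 0 < delta_infty by exact: delta_of_gt0 (ltW ai_gt0).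
(* The partial sums of these squares are the [K n], bounded by [m0^-1]. *)
have p_cvg0 : (p n).[x0] ^+ 2 @[n --> \oo] --> 0.
  apply: cvg_series_cvg_0; apply: nondecreasing_is_cvgn.
    by apply: nondecreasing_series => n _ _; exact: sqr_ge0.
  exists m0^-1 => _ [n _ <-].
  have := cd_kernel_diag_le size_p L_p m0_gt0 L_mass n.
  rewrite /cd_kernel horner_sum /series /= big_mkord; congr (_ <= _).
  by apply: eq_bigr => i _; rewrite hornerZ expr2.
have p0_gt0 := p0_sqr_gt0 size_p x0.
(* Below this threshold [no_close_root_le] fails for the radius [delta_infty], so a close root must
   exist. *)
pose e := delta_infty ^+ 2 * (p 0%N).[x0] ^+ 2 / a_infty ^+ 2.
have e_gt0 : 0 < e by rewrite divr_gt0 ?(mulr_gt0 _ p0_gt0) // exprn_gt0.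
have [N _ small] : \forall n \near \oo, (p n).[x0] ^+ 2 < e.
  exact: (cvgr_lt _ p_cvg0).
have ge1 n : (N <= n.+1)%N -> (0 < nzeros (p n.+1) x0 delta_infty)%N.
  move=> Nn; rewrite lt0n; apply/eqP => /(nzeros_eq0 (p_neq0 _)) far.
  have := no_close_root_le size_p L_p L_ge0 rec0 recS far (ltW di_gt0).
  apply/negP; rewrite -ltNge; apply: (@le_lt_trans _ _ (a_infty ^+ 2 * (p
    n.+1).[x0] ^+ 2)).
    by rewrite ler_wpM2r ?sqr_ge0 // lerXn2r ?nnegrE // ltW.
  by rewrite mulrC -ltr_pdivlMr ?exprn_gt0 //; exact: small.
have le_delta n : delta_infty <= delta_of d0 (a n.+1).
  by apply: delta_of_le => //; exact: ltW.
(* As [delta_infty] is at most every [delta_of d0 (a m.+1)], the bound by one root carries over to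
   the smaller interval. *)
have nz_le n m := nzeros_le x0 (p_neq0 n) (le_delta m).
exists N.+1 => // -[//|n] /= Nn.
have [le|le] := le1 n.+1; [left|right]; apply/eqP; rewrite eqn_leq.
  by rewrite (leq_trans (nz_le _ _) le) ge1 // ltnW.
by rewrite (leq_trans (nz_le _ _) le) ge1 // ltnW // ltnW.
Qed.
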